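(* Let $r\ge 3$ be an integer and $0<\gamma<1$. Then $$\mu\big(r,0,\gamma A+(1-\gamma)B\big)=\frac{r\gamma(1-\gamma)(2-\gamma)\big[(2-\gamma)^{r-2}-\gamma^{r-2}\big]}{2\big[(2-\gamma)^r-\gamma^r\big]+r\gamma(2-\gamma)\big[(2-\gamma)^{r-2}-\gamma^{r-2}\big]},$$ regardless of initial capital, where $\mu(r,0,\gamma A+(1-\gamma)B)$ is the rate of profit defined in the context.
   Context: A $p$-coin is a coin with probability $p$ of heads. A player has an integer-valued capital; in each game the player wins one unit with heads and loses one unit with tails. In game $A$ a fair coin is tossed. In game $B$ (with integer parameter $r\ge3$ and real parameter $\rho\in[0,1)$) a $p_0$-coin is tossed if the current capital is a multiple of $r$, and a $p_1$-coin otherwise, where $p_0=\rho^{r-1}/(1+\rho^{r-1})$ and $p_1=1/(1+\rho)$. Here $\rho=0$, so $p_0=0$ and $p_1=1$: in game $B$ the player surely loses one unit if capital is a multiple of $r$ and surely wins one unit otherwise. The random mixture $\gamma A+(1-\gamma)B$ means that at each turn, independently, game $A$ is played with probability $\gamma$ and game $B$ is played otherwise. Thus, for $\rho=0$, capital is a nearest-neighbor Markov chain on $\mathbb{Z}$ which moves from $x$ to $x+1$ with probability $\frac{\gamma}{2}$ if $r\mid x$ and $1-\frac{\gamma}{2}$ if $r\nmid x$, and otherwise moves to $x-1$. If $S_n$ denotes the cumulative profit (current capital minus initial capital) after $n$ turns, the rate of profit $\mu(r,0,\gamma A+(1-\gamma)B)$ is the almost sure limit $\lim_{n\to\infty}n^{-1}S_n$.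 *)

(* Defs.v *)
(* MathComp / MathComp-Analysis. *)
From HB Require Import structures.
From mathcomp Require Import all_boot all_order all_algebra.
From mathcomp Require Import all_classical all_reals all_analysis.

Set Implicit Arguments.
Unset Strict Implicit.
Unset Printing Implicit Defensive.

Import Order.TTheory GRing.Theory Num.Theory.
Import numFieldNormedType.Exports.

Local Open Scope classical_set_scope.
Local Open Scope ring_scope.

(* A game maps the current capital to the probability of heads. *)
Definition game (R : realType) := int -> R.

Definition game_A (R : realType) : game R := fun=> 1 / 2.

Definition coin_p0 (R : realType) (r : nat) (rho : R) : R :=
  rho ^+ (r - 1) / (1 + rho ^+ (r - 1)).

Definition coin_p1 (R : realType) (rho : R) : R := 1 / (1 + rho).

Definition game_B (R : realType) (r : nat) (rho : R) : game R :=
  fun x => if (r%:Z %| x)%Z then coin_p0 r rho else coin_p1 rho.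

Definition step_prob (R : realType) (W : game R) (x y : int) : R :=
  if y == x + 1 then W x else if y == x - 1 then 1 - W x else 0.

(* [G n = true] means that the first of the two games is played at turn [n]
   (turns are numbered from 0); [X n] is the capital after [n] turns. Only the
   values [g i], [i < n], and [x i], [i <= n], matter. *)
Definition history (T : Type) (G : nat -> T -> bool) (X : nat -> T -> int)
    (n : nat) (g : nat -> bool) (x : nat -> int) : set T :=
  [set w | (forall i, (i < n)%N -> G i w = g i) /\
           (forall i, (i <= n)%N -> X i w = x i)].

(* Capital when the random mixture [gamma W1 + (1 - gamma) W2] is played from
   initial capital [x0]: given everything that happened during the first [n]
   turns, [W1] is chosen with probability [gamma] and [W2] otherwise, and the
   coin of the chosen game at the current capital is then tossed. The last
   clause is the conditional law of turn [n] in product form. *)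
Definition mixture_play (R : realType) (gamma : R) (W1 W2 : game R) (x0 : int)
    (d : measure_display) (T : measurableType d) (P : probability T R)
    (G : nat -> T -> bool) (X : nat -> T -> int) : Prop :=
  [/\ forall n b, measurable (G n @^-1` [set b]),
      forall n y, measurable (X n @^-1` [set y]),
      P (X 0%N @^-1` [set x0]) = 1%E
    & forall (n : nat) (g : nat -> bool) (x : nat -> int),
        P (history G X n.+1 g x) =
        (P (history G X n g x) *
         ((if g n then gamma else 1 - gamma) *
          step_prob (if g n then W1 else W2) (x n) (x n.+1))%:E)%E].

Definition profit (T : Type) (X : nat -> T -> int) (n : nat) (w : T) : int :=
  X n w - X 0%N w.

Definition is_rate_of_profit (R : realType) (d : measure_display)
    (T : measurableType d) (P : probability T R) (X : nat -> T -> int)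
    (mu : R) : Prop :=
  {ae P, forall w,
    (fun n : nat => (profit X n w)%:~R / n%:R : R) @ \oo --> mu}.

(* Main.v *)
(* Let [W x] be the probability of an upward step from [x] in the mixture. If
   [h] is an [r]-periodic function and [f x = x + h x] solves the Poisson
   equation [W x * f (x + 1) + (1 - W x) * f (x - 1) = f x + mu], then
   [M_n = f (X_n) - f (x0) - n mu] is a martingale with bounded increments, so
   its fourth moment is [O(n^2)] and the expectation of the sum of all
   [(M_n / n)^4] is finite. Hence [M_n / n] tends to [0] almost surely, and the
   rate of profit is [mu] because [h] is bounded. Since [M_n] is a function of
   [X_n] alone, its moments are given by iterates of the one-step operator.
   Solvability of the Poisson equation with a periodic [h] determines [mu]. *)
Require Import Defs.
From HB Require Import structures.
From mathcomp Require Import all_boot all_order all_algebra.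
From mathcomp Require Import all_classical all_reals all_analysis.
From mathcomp Require Import measurable_realfun.
From mathcomp Require Import ring lra zify.

Import Order.TTheory GRing.Theory Num.Theory.
Import numFieldNormedType.Exports.

Local Open Scope classical_set_scope.
Local Open Scope ring_scope.

Set Implicit Arguments.
Unset Strict Implicit.
Unset Printing Implicit Defensive.

(** * One-step operator of a walk and fourth moments along it *)

Definition walk_op {R : realType} (W : game R) (phi : int -> R) (x : int) : R :=
  W x * phi (x + 1) + (1 - W x) * phi (x - 1).

Definition mix_game {R : realType} (gamma : R) (W1 W2 : game R) : game R :=
  fun x => gamma * W1 x + (1 - gamma) * W2 x.

Lemma mix_game_itv (R : realType) (gamma : R) (W1 W2 : game R) (x : int) :
  0 <= gamma <= 1 -> 0 <= W1 x <= 1 -> 0 <= W2 x <= 1 ->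
  0 <= mix_game gamma W1 W2 x <= 1.
Proof. by rewrite /mix_game; nra. Qed.

Lemma walk_op_le (R : realType) (W : game R) (phi psi : int -> R) (x : int) :
  0 <= W x <= 1 -> (forall y, phi y <= psi y) ->
  walk_op W phi x <= walk_op W psi x.
Proof.
move=> /andP[W0 W1] le; rewrite /walk_op lerD// ler_wpM2l//.
by rewrite subr_ge0.
Qed.

(** The term linear in [d] is kept exactly because it averages to zero over a martingale step. After
    the binomial expansion, the square terms collect [6 + 2] and the fourth powers [1 + 2]. *)
Lemma fourth_power_increment_le (R : realType) (B g d : R) : `|d| <= B ->
  (g + d) ^+ 4 <= g ^+ 4 + 4 * g ^+ 3 * d + 8 * B ^+ 2 * g ^+ 2 + 3 * B ^+ 4.
Proof.
move=> dB.
have d2B2 : d ^+ 2 <= B ^+ 2.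
  by rewrite -(real_normK (num_real d)) lerXn2r// nnegrE ?(le_trans _ dB).
have d4B4 : d ^+ 4 <= B ^+ 4.
  by rewrite (exprM d 2 2) (exprM B 2 2) lerXn2r// nnegrE sqr_ge0.
(* AM-GM: [2 g d <= g^2 + d^2], multiplied by [2 d^2] *)
have cross_le : 4 * g * d ^+ 3 <= 2 * g ^+ 2 * d ^+ 2 + 2 * d ^+ 4.
  have : 0 <= 2 * (d * (g - d)) ^+ 2 by rewrite mulr_ge0 ?sqr_ge0.
  lra.
have : g ^+ 2 * d ^+ 2 <= g ^+ 2 * B ^+ 2 by rewrite ler_wpM2l ?sqr_ge0.
lra.
Qed.

(* [f y - n mu] is a martingale along the walk, by the Poisson equation
   [walk_op W f = f + mu]. *)
Lemma walk_fourth_moment (R : realType) (W : game R) (f : int -> R) (mu B : R) :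
  (forall x, 0 <= W x <= 1) ->
  (forall x, walk_op W f x = f x + mu) ->
  (forall x, `|f (x + 1) - f x - mu| <= B) ->
  (forall x, `|f (x - 1) - f x - mu| <= B) ->
  forall n c x,
    iter n (walk_op W) (fun y => (f y - c - n%:R * mu) ^+ 4) x <=
    (f x - c) ^+ 4 + 8 * B ^+ 2 * n%:R * (f x - c) ^+ 2 +
      4 * B ^+ 4 * n%:R ^+ 2.
Proof.
move=> W01 Wf up dn; elim=> [|n IHn] c x.
  by rewrite /= mul0r subr0 !expr0n/= !mulr0 mul0r !addr0.
rewrite iterS.
(* The induction peels off the first step of the walk, whose drift [mu] is absorbed into [c]; hence
   the quantification over [c]. *)
have -> : (fun y => (f y - c - n.+1%:R * mu) ^+ 4) =
          (fun y => (f y - (c + mu) - n%:R * mu) ^+ 4).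
  by apply/funext => y; rewrite -natr1; congr (_ ^+ 4); ring.
apply: le_trans (walk_op_le (W01 x) (IHn (c + mu))) _.
rewrite /walk_op.
set g := f x - c.
set d1 := f (x + 1) - f x - mu; set d2 := f (x - 1) - f x - mu.
have -> : f (x + 1) - (c + mu) = g + d1 by rewrite /g /d1; ring.
have -> : f (x - 1) - (c + mu) = g + d2 by rewrite /g /d2; ring.
have mean0 : W x * d1 + (1 - W x) * d2 = 0.
  have := Wf x; rewrite /walk_op /d1 /d2 => /eqP; rewrite -subr_eq0 => /eqP <-.
  by ring.
(* The last summand is linear in [d] and will average out. The multiples of [B ^+ 4] fit because
   [8 n + 3 <= 4 (n + 1)^2 - 4 n^2]. *)
have bound d : `|d| <= B ->
  (g + d) ^+ 4 + 8 * B ^+ 2 * n%:R * (g + d) ^+ 2 + 4 * B ^+ 4 * n%:R ^+ 2 <=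
  g ^+ 4 + 8 * B ^+ 2 * n.+1%:R * g ^+ 2 + 4 * B ^+ 4 * n.+1%:R ^+ 2 +
  (4 * g ^+ 3 + 16 * B ^+ 2 * n%:R * g) * d.
  move=> dB; have h4 := fourth_power_increment_le g dB.
  have d2B2 : d ^+ 2 <= B ^+ 2.
    by rewrite -(real_normK (num_real d)) lerXn2r// nnegrE ?(le_trans _ dB).
  have h2 : 8 * B ^+ 2 * n%:R * d ^+ 2 <= 8 * B ^+ 2 * n%:R * B ^+ 2.
    by rewrite ler_wpM2l// mulr_ge0// mulr_ge0// sqr_ge0.
  have B4 : 0 <= B ^+ 4 by rewrite (exprM B 2 2) sqr_ge0.
  rewrite -natr1; lra.
have /andP[W0 W1] := W01 x.
have b1 := ler_wpM2l W0 (bound d1 (up x)).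
have W1' : 0 <= 1 - W x by rewrite subr_ge0.
have b2 := ler_wpM2l W1' (bound d2 (dn x)).
apply: le_trans (lerD b1 b2) _; rewrite le_eqVlt; apply/orP; left; apply/eqP.
set L := 4 * g ^+ 3 + _.
transitivity (g ^+ 4 + 8 * B ^+ 2 * n.+1%:R * g ^+ 2 +
  4 * B ^+ 4 * n.+1%:R ^+ 2 + L * (W x * d1 + (1 - W x) * d2)).
  by ring.
by rewrite mean0 mulr0 addr0.
Qed.

(** * Almost sure convergence from summable expectations *)

Lemma is_cvg_series_inv_sqr (R : realType) :
  cvgn (series (fun n => n.+1%:R ^- 2 : R)).
Proof.
(* Telescoping: [1 / (x + 1)^2 <= 1 / x - 1 / (x + 1)]. *)
have S_le n : series (fun n => n.+1%:R ^- 2 : R) n.+1 <= 2 - n.+1%:R^-1.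
  elim: n => [|n IHn].
    by rewrite /series/= big_nat1 expr1n invr1; lra.
  rewrite seriesSr; apply: le_trans (lerD IHn (lexx _)) _.
  have : 0 < (n.+1%:R : R) by rewrite ltr0n.
  rewrite -[n.+2%:R]natr1; move: (n.+1%:R) => /= x x0.
  rewrite -subr_ge0 (_ : _ - _ = (x * (x + 1) ^+ 2)^-1).
    by rewrite invr_ge0 mulr_ge0 ?sqr_ge0// ltW.
  by field; apply/andP; split; lra.
have S_mono : nondecreasing_seq (series (fun n => n.+1%:R ^- 2 : R)).
  by apply/nondecreasing_series => i _ _; rewrite invr_ge0 sqr_ge0.
apply: nondecreasing_is_cvgn => //.
exists 2 => _ [n _ <-]; apply: le_trans (S_mono _ _ (leqnSn n)) _.
by apply: le_trans (S_le n) _; rewrite lerBlDr lerDl invr_ge0.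
Qed.

(** By monotone convergence the sum of all [Z n] has a finite integral, so it is finite almost
    everywhere, and there its terms tend to 0. *)
Lemma ae_cvg0_of_summable_integral (R : realType) (d : measure_display)
    (T : measurableType d) (P : {measure set T -> \bar R})
    (Z : nat -> T -> R) (c : nat -> R) :
  (forall n, measurable_fun setT (Z n)) -> (forall n w, 0 <= Z n w) ->
  cvgn (series c) -> (forall n, \int[P]_w (Z n w)%:E <= (c n)%:E)%E ->
  {ae P, forall w, (fun n => Z n w) @ \oo --> (0 : R)}.
Proof.
move=> mZ Z0 cc intZ.
have mEZ n : measurable_fun setT (fun w => (Z n w)%:E).
  exact/measurable_EFinP.
have EZ0 n w : (0 <= (Z n w)%:E)%E by rewrite lee_fin.
have intS : (\int[P]_w (\sum_(n <oo) (Z n w)%:E) < +oo)%E.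
  rewrite integral_nneseries//.
  apply: (@le_lt_trans _ _ (\sum_(n <oo) (c n)%:E)%E).
    by apply: lee_nneseries => // n _ _; exact: integral_ge0.
  under eq_fun do rewrite sumEFin.
  by rewrite EFin_lim// ltry.
have S0 w : (0 <= \sum_(n <oo) (Z n w)%:E)%E by exact: nneseries_ge0.
have : P.-integrable setT (fun w => \sum_(n <oo) (Z n w)%:E)%E.
  apply/integrableP; split.
    exact: ge0_emeasurable_sum.
  by under eq_integral do rewrite gee0_abs//.
move=> /integrable_ae -/(_ measurableT); apply: filterS => w /(_ I) fin.
apply: cvg_series_cvg_0; apply: nnseries_is_cvg => //.
by rewrite -ge0_fin_numE.
Qed.

(** * Law of the capital, computed on finite histories *)

Section mixture.
Variables (R : realType) (gamma : R) (W1 W2 : game R) (x0 : int).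
Variables (d : measure_display) (T : measurableType d) (P : probability T R).
Variables (G : nat -> T -> bool) (X : nat -> T -> int).
Hypotheses (gamma01 : 0 <= gamma <= 1)
  (W1_itv : forall x, 0 <= W1 x <= 1) (W2_itv : forall x, 0 <= W2 x <= 1).
Hypothesis play : mixture_play gamma W1 W2 x0 P G X.
Let W := mix_game gamma W1 W2.

Lemma measurable_capital (phi : int -> R) n :
  measurable_fun setT (fun w => phi (X n w)).
Proof.
have [_ mX _ _] := play.
move=> _ Y _; rewrite setTI.
have -> : (fun w => phi (X n w)) @^-1` Y =
          \bigcup_y (X n @^-1` [set y] `&` [set _ | Y (phi y)]).
  apply/seteqP; split => [w /= Yw|w [y _ [/= <-]]//].
  by exists (X n w).
apply: countable_bigcupT_measurable => // y.
apply: measurableI => //.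
by have [h|h] := pselect (Y (phi y));
  [rewrite (_ : mkset _ = setT)|rewrite (_ : mkset _ = set0)] => //;
  apply/seteqP; split.
Qed.

Lemma measurable_history n g x : measurable (history G X n g x).
Proof.
have [mG mX _ _] := play.
have -> : history G X n g x =
    \bigcap_(i in `I_n) (G i @^-1` [set g i]) `&`
    \bigcap_(i in `I_n.+1) (X i @^-1` [set x i]) by [].
by apply: measurableI; apply: bigcap_measurableType => i _.
Qed.

Definition extend_modes (g : nat -> bool) n (b : bool) : nat -> bool :=
  fun i => if i == n then b else g i.
Definition extend_path (x : nat -> int) n (s : bool) : nat -> int :=
  fun i => if i == n.+1 then (if s then x n + 1 else x n - 1) else x i.
(** The four one-turn continuations of a history: [c.1] tells whether the first game is chosen,
    [c.2] whether the coin shows heads. *)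
Definition history_child n g x (c : bool * bool) : set T :=
  history G X n.+1 (extend_modes g n c.1) (extend_path x n c.2).
Definition child_prob (x : int) (c : bool * bool) : R :=
  (if c.1 then gamma else 1 - gamma) *
  (let p := if c.1 then W1 x else W2 x in if c.2 then p else 1 - p).

Lemma history_child_sub n g x c : history_child n g x c `<=` history G X n g x.
Proof.
move=> w [hG hX]; split => i ni.
  by rewrite hG ?ltnS 1?ltnW// /extend_modes ltn_eqF.
by rewrite hX 1?(leq_trans ni)// /extend_path ltn_eqF// ltnS.
Qed.

Lemma prob_history_child n g x c :
  P (history_child n g x c) =
  (P (history G X n g x) * (child_prob (x n) c)%:E)%E.
Proof.
have [_ _ _ hP] := play.
rewrite /history_child hP.
congr (P _ * _%:E)%E.
  by apply/seteqP; split=> w [hG hX]; split=> i ni; rewrite ?hG ?hX//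
    /extend_modes /extend_path ltn_eqF// ltnS.
rewrite /extend_modes /extend_path eqxx ltn_eqF// eqxx /step_prob /child_prob.
case: c => [b []] /=; first by rewrite eqxx; case: b.
rewrite eqxx (_ : (x n - 1 == x n + 1) = false); first by case: b.
by apply/negbTE/eqP; lia.
Qed.

Lemma trivIset_history_child n g x :
  trivIset setT (history_child n g x).
Proof.
move=> [b s] [b' s'] _ _ [w [[/= hG hX] [/= hG' hX']]].
have := hG n (ltnSn n); rewrite hG' // /extend_modes eqxx => <-.
have := hX n.+1 (leqnn _); rewrite hX' // /extend_path eqxx => e.
by congr pair; case: s s' e {hX hX'} => [] [] //; lia.
Qed.

Lemma measurable_history_child n g x c : measurable (history_child n g x c).
Proof. exact: measurable_history. Qed.

Let modes : seq (bool * bool) :=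
  [:: (true, true); (true, false); (false, true); (false, false)].

(** Capital moves by one unit only almost surely, so the children need not cover the history as a
    set. Their probabilities add up to that of the history, so the rest is negligible. *)
Lemma integral_history_split n g x (phi : T -> R) :
  measurable_fun setT phi -> (forall w, 0 <= phi w) ->
  (\int[P]_(w in history G X n g x) (phi w)%:E =
   \sum_(c <- modes) \int[P]_(w in history_child n g x c) (phi w)%:E)%E.
Proof.
move=> mphi phi0.
set F := history_child n g x; set H := history G X n g x.
have mF c : measurable (F c) by exact: measurable_history_child.
have mH : measurable H by exact: measurable_history.
have tF : trivIset [set` modes] F.
  exact: sub_trivIset (@trivIset_history_child n g x).
set U := \big[setU/set0]_(c <- modes) F c.
have mU : measurable U by exact: bigsetU_measurable.
have UH : U `<=` H.
  by rewrite /U -bigcup_seq => w [c _]; exact: history_child_sub.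
have PU : P U = P H.
  have -> : P U = (\int[P]_(w in U) (1:R)%:E)%E by rewrite integral_cst// mul1e.
  rewrite ge0_integral_bigsetU//.
  transitivity (\sum_(c <- modes) (P H * (child_prob (x n) c)%:E))%E.
    apply: eq_bigr => c _; rewrite integral_cst// mul1e.
    exact: prob_history_child.
  rewrite /modes !big_cons big_nil /child_prob/= adde0 -/H.
  have : P H \is a fin_num by exact: fin_num_measure.
  case: (P H) => // p _; rewrite -!EFinM -!EFinD; congr EFin; ring.
have PHU : P (H `\` U) = 0%E.
  rewrite measureD//=; last by rewrite -ge0_fin_numE// fin_num_measure.
  by rewrite (setIidr UH) PU subee// fin_num_measure.
rewrite (@ge0_negligible_integral _ _ _ P H (H `\` U))//; last 3 first.
- exact: measurableD.
- by apply/measurable_EFinP; apply: measurable_funTS.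
- by move=> w _; rewrite lee_fin.
rewrite setDD (setIidr UH).
rewrite ge0_integral_bigsetU//.
- by apply/measurable_EFinP; apply: measurable_funTS.
- by move=> w _; rewrite lee_fin.
Qed.

(** The Markov property in integrated form. Each child is a history of length [m + 1] with one turn
    fewer to go, and summing [child_prob] over the choice of game gives one application of
    [walk_op W]. *)
Lemma integral_history (phi : int -> R) : (forall y, 0 <= phi y) ->
  forall n m g x,
  (\int[P]_(w in history G X m g x) (phi (X (m + n)%N w))%:E =
   P (history G X m g x) * (iter n (walk_op W) phi (x m))%:E)%E.
Proof.
move=> phi0; elim=> [|n IHn] m g x.
  rewrite addn0 /=.
  under eq_integral => w do [rewrite inE => -[_ /(_ m (leqnn m)) ->]].
  by rewrite integral_cst; [rewrite muleC|exact: measurable_history].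
rewrite integral_history_split//; last exact: measurable_capital.
transitivity (\sum_(c <- modes)
    (P (history G X m g x) * (child_prob (x m) c)%:E *
     (iter n (walk_op W) phi (if c.2 then x m + 1 else x m - 1))%:E))%E.
  apply: eq_bigr => c _.
  by rewrite -addSnnS IHn prob_history_child /extend_path eqxx.
rewrite iterS {2}/walk_op /W /mix_game /modes !big_cons big_nil /child_prob/=.
rewrite adde0.
have : P (history G X m g x) \is a fin_num.
  exact: fin_num_measure (measurable_history _ _ _).
case: (P _) => // p _; rewrite -!EFinM -!EFinD; congr EFin; ring.
Qed.

Lemma integral_capital (phi : int -> R) n : (forall y, 0 <= phi y) ->
  (\int[P]_w (phi (X n w))%:E = (iter n (walk_op W) phi x0)%:E)%E.
Proof.
move=> phi0; have [_ mX P0 _] := play.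
(* A history of length zero constrains only the initial capital, so this event is almost sure. *)
pose H := history G X 0 (fun=> true) (fun=> x0).
have HE : H = X 0 @^-1` [set x0].
  apply/seteqP; split=> [w [_]|w /= Xw]; first exact.
  by split=> // i; rewrite leqn0 => /eqP ->.
have mH : measurable H by exact: measurable_history.
have PH : P H = 1%E by rewrite HE.
rewrite (@ge0_negligible_integral _ _ _ P setT (~` H))//.
- by rewrite setDE setCK setTI -[n]add0n integral_history// PH mul1e.
- exact: measurableC.
- by apply/measurable_EFinP; exact: measurable_capital.
- by move=> w _; rewrite lee_fin.
- by rewrite [LHS]probability_setC// PH subee.
Qed.

(** * Strong law for the capital from a solution of the Poisson equation *)

Lemma rate_of_profit_poisson (h : int -> R) (H mu : R) :
  (forall x, `|h x| <= H) ->
  (forall x, walk_op W (fun y => y%:~R + h y) x = x%:~R + h x + mu) ->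
  is_rate_of_profit P X mu.
Proof.
move=> hH poisson; have [_ mX P0 _] := play.
pose f x : R := x%:~R + h x; pose B := 1 + 2 * H + `|mu|.
have W01 x : 0 <= W x <= 1 by exact: mix_game_itv.
have incr x y : `|x%:~R - y%:~R : R| <= 1 -> `|f x - f y - mu| <= B.
  move=> xy; have -> : f x - f y - mu = (x%:~R - y%:~R) + (h x - h y) - mu.
    by rewrite /f; ring.
  rewrite (le_trans (ler_normB _ _))// lerD2r (le_trans (ler_normD _ _))//.
  rewrite lerD// (le_trans (ler_normB _ _))// mulr_natl mulr2n lerD//.
have up x : `|f (x + 1) - f x - mu| <= B.
  by apply: incr; rewrite intrD addrAC subrr add0r normr1.
have dn x : `|f (x - 1) - f x - mu| <= B.
  by apply: incr; rewrite intrB addrAC subrr add0r normrN normr1.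
pose M n w := f (X n w) - f x0 - n%:R * mu.
(* Starting at index one keeps the divisor nonzero. *)
pose Z n w := (M n.+1 w / n.+1%:R) ^+ 4.
have fourth_ge0 (x : R) : 0 <= x ^+ 4 by rewrite (exprM x 2 2) sqr_ge0.
have mZ n : measurable_fun setT (Z n).
  exact: (measurable_capital
            (fun y => ((f y - f x0 - n.+1%:R * mu) / n.+1%:R) ^+ 4)).
have cvgZ : {ae P, forall w, (fun n => Z n w) @ \oo --> (0 : R)}.
  (* With [c = f x0] the moment bound at the starting point reduces to [4 B^4 k^2], where
     [k = n.+1]; division by [k^4] gives this sequence. *)
  apply: (@ae_cvg0_of_summable_integral _ _ _ P Z
           (fun n => 4 * B ^+ 4 * n.+1%:R ^- 2)) => //.
  - by move=> n w; exact: fourth_ge0.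
  - exact/is_cvg_seriesZ/is_cvg_series_inv_sqr.
  move=> n.
  have n4 : 0 <= n.+1%:R ^- 4 :> R by rewrite invr_ge0.
  under eq_integral => w _ do rewrite /Z expr_div_n mulrC EFinM.
  rewrite ge0_integralZl_EFin//; last 2 first.
  - by move=> w _; rewrite lee_fin.
  - by apply/measurable_EFinP;
      exact: (measurable_capital (fun y => (f y - f x0 - n.+1%:R * mu) ^+ 4)).
  rewrite (integral_capital
             (phi := fun y => (f y - f x0 - n.+1%:R * mu) ^+ 4))//.
  rewrite -EFinM lee_fin.
  have := walk_fourth_moment W01 poisson up dn n.+1 (f x0) x0.
  rewrite subrr !expr0n/= mulr0 !add0r => le4.
  apply: le_trans (ler_wpM2l n4 le4) _.
  rewrite le_eqVlt; apply/orP; left; apply/eqP.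
  have : n.+1%:R != 0 :> R by rewrite pnatr_eq0.
  by move: (n.+1%:R) => k k0; field.
have X0 : {ae P, forall w, X 0 w = x0}.
  exists (~` (X 0 @^-1` [set x0])); split.
  - exact: measurableC.
  - by rewrite [LHS]probability_setC// P0 subee.
  - by move=> w.
move: cvgZ X0; apply: filterS2 => w Zw X0w.
rewrite -cvg_shiftS.
(* The average profit is [mu] plus a martingale average minus a bounded term over [n.+1]. *)
have -> : [sequence (profit X n.+1 w)%:~R / n.+1%:R]_n =
    (fun n => mu + (M n.+1 w / n.+1%:R - (h (X n.+1 w) - h x0) * n.+1%:R^-1)).
  apply/funext => n /=; rewrite /profit /M /f X0w intrB.
  have : n.+1%:R != 0 :> R by rewrite pnatr_eq0.
  by move: (n.+1%:R) => k k0; field.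
suff : (fun n => M n.+1 w / n.+1%:R - (h (X n.+1 w) - h x0) * n.+1%:R^-1)
    @ \oo --> (0 - 0 : R).
  by rewrite subr0 => /(cvgD (cvg_cst mu)); rewrite addr0.
apply: cvgB.
  apply/cvgr0Pnorm_lt => e e0.
  have e4 : 0 < e ^+ 4 by rewrite exprn_gt0.
  move/cvgr0Pnorm_lt : Zw => /(_ _ e4); apply: filterS => n.
  by rewrite /Z normrX ltr_pXn2r// nnegrE ?normr_ge0// ltW.
apply: norm_cvg0.
apply: (@squeeze_cvgr _ _ _ _ (cst 0) (fun n => (H + H) * harmonic n)).
- near=> n; rewrite normr_ge0/= normrM [X in _ * X]ger0_norm ?invr_ge0//.
  by rewrite ler_wpM2r ?invr_ge0// (le_trans (ler_normB _ _))// lerD.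
- exact: cvg_cst.
- have := cvgM (cvg_cst (H + H)) (@cvg_harmonic R); rewrite mulr0; exact.
Unshelve. all: by end_near.
Qed.

End mixture.

(** * Explicit solution of the Poisson equation for games A and B *)

Section poisson_solution.
Variables (R : realType) (r : nat) (gamma : R).
Hypotheses (hr : (3 <= r)%N) (gamma0 : 0 < gamma) (gamma1 : gamma < 1).
Let s : R := 2 - gamma.
Let D : R := s ^+ (r - 2) - gamma ^+ (r - 2).

Definition profit_rate : R :=
  r%:R * gamma * (1 - gamma) * s * D /
  (2 * (s ^+ r - gamma ^+ r) + r%:R * gamma * s * D).
Let mu : R := profit_rate.

(* The increment [f (x + 1) - f x] of the solution [f] of the Poisson equation
   at [x = k] modulo [r]: a solution of [slope_succ] is a constant plus a
   geometric sequence, and [slope_wrap] fixes the coefficient of the latter.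
   The value of [mu] is then forced by [sum_slope], which makes [f x - x]
   periodic. *)
Definition slope (k : nat) : R :=
  mu / (1 - gamma) +
  4 * mu * s ^+ (r - 2) / (gamma * D) * (gamma / s) ^+ k.

Lemma geo_diff_gt0 n : (0 < n)%N -> 0 < s ^+ n - gamma ^+ n.
Proof.
move=> n0; have lt_s : gamma < s by have := gamma1; rewrite /s; lra.
by rewrite subr_gt0 ltrXn2r -?lt0n// ltW.
Qed.

(** Twice the Poisson equation at capital congruent to [k.+1], not a multiple of [r], where the
    upward probability is [s / 2]. *)
Lemma slope_succ k : s * slope k.+1 - gamma * slope k = 2 * mu.
Proof.
have [g0 g1] := (gamma0, gamma1).
have D0 : 0 < D by rewrite geo_diff_gt0// subn_gt0.
rewrite /slope exprS; move: ((gamma / s) ^+ k) (s ^+ (r - 2)) D D0 mu => *.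
by rewrite /s; field; rewrite !gt_eqF//=; lra.
Qed.

(** Twice the Poisson equation at a multiple of [r], where the upward probability is [gamma / 2]. *)
Lemma slope_wrap : gamma * slope 0 - s * slope r.-1 = 2 * mu.
Proof.
have [g0 g1] := (gamma0, gamma1).
have D0 : 0 < D by rewrite geo_diff_gt0// subn_gt0.
have s0 : 0 < s by rewrite /s; lra.
rewrite /slope expr0.
have -> : (gamma / s) ^+ r.-1 = gamma * gamma ^+ (r - 2) / (s * s ^+ (r - 2)).
  by rewrite expr_div_n -!exprS; congr (_ ^+ _ / _ ^+ _); lia.
have sn0 : s ^+ (r - 2) != 0 by rewrite expf_neq0// gt_eqF.
move: D0 sn0; rewrite /D.
move: (s ^+ (r - 2)) (gamma ^+ (r - 2)) mu => a b m D0 a0.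
rewrite /s; field; rewrite a0 !gt_eqF//=; lra.
Qed.

(** Summing the geometric part turns this into an equation linear in [mu], and [profit_rate] is its
    solution. *)
Lemma sum_slope : \sum_(k < r) slope k = r%:R.
Proof.
have [g0 g1] := (gamma0, gamma1).
have D0 : 0 < D by rewrite geo_diff_gt0// subn_gt0.
have s0 : 0 < s by rewrite /s; lra.
have E0 : 0 < s ^+ r - gamma ^+ r by rewrite geo_diff_gt0//; lia.
rewrite /slope big_split/= sumr_const card_ord -[_ *+ r]mulr_natl -mulr_sumr.
set S := \sum_(k < r) _.
have geo : (1 - gamma / s) * S = 1 - (gamma / s) ^+ r.
  by rewrite -(opprB (gamma / s)) mulNr -subrX1 opprB.
have th1 : 1 - gamma / s != 0.
  by rewrite subr_eq0 eq_sym; apply/eqP => /divr1_eq; rewrite /s; lra.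
have -> : S = (1 - (gamma / s) ^+ r) / (1 - gamma / s).
  by rewrite -geo mulrAC mulfV// mul1r.
have r0 : 0 < r%:R :> R by rewrite ltr0n; lia.
(* All powers are reduced to exponent [r - 2], so that [field] sees a rational identity in
   independent atoms. *)
have pow2 (x : R) : x ^+ r = x ^+ 2 * x ^+ (r - 2).
  by rewrite -exprD; congr (_ ^+ _); lia.
have a0 : s ^+ (r - 2) != 0 by rewrite expf_neq0// gt_eqF.
move: E0 D0 a0; rewrite /mu /profit_rate expr_div_n !pow2 /D.
move: (s ^+ (r - 2)) (gamma ^+ (r - 2)) (r%:R) r0 => a b k k0 E0 D0 a0.
have den0 : 0 < 2 * (s ^+ 2 * a - gamma ^+ 2 * b) + k * gamma * s * (a - b).
  by rewrite addr_gt0 ?mulr_gt0.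
move: E0 den0; rewrite /s => E0 den0; field.
rewrite a0 !gt_eqF//=; lra.
Qed.

(** The periodic part [h] of the solution, built by summing the increments of [f x - x] from residue
    0. *)
Let h_nat (k : nat) : R := \sum_(j < k) (slope j - 1).
Definition corrector (x : int) : R := h_nat `|(x %% r)%Z|%N.

Let r_gt0 : (0 < r)%N. Proof. exact: ltn_trans hr. Qed.

Lemma absz_mod_lt x : (`|(x %% r)%Z| < r)%N.
Proof.
by rewrite -ltz_nat gez0_abs ?modz_ge0 ?ltz_pmod//; move: r_gt0; case: r.
Qed.

Lemma absz_mod_succ x : `|((x + 1) %% r)%Z|%N =
  if `|(x %% r)%Z|.+1 == r then 0%N else `|(x %% r)%Z|.+1.
Proof.
have mod0 : (0 <= x %% r)%Z by rewrite modz_ge0//; move: r_gt0; case: r.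
have mod_lt := absz_mod_lt x.
rewrite {1}(divz_eq x r) -addrA modzMDl -{1}(gez0_abs mod0) -PoszD addn1.
rewrite modz_nat/=.
case: eqP => [->|ne]; first exact: modnn.
by rewrite modn_small// ltn_neqAle mod_lt andbT; apply/eqP.
Qed.

Lemma corrector_bounded : exists H : R, forall x, `|corrector x| <= H.
Proof.
exists (\sum_(k < r) `|h_nat k|) => x.
have xr := absz_mod_lt x.
by rewrite (bigD1 (Ordinal xr))//= lerDl sumr_ge0.
Qed.

Lemma corrector_succ x :
  corrector (x + 1) = corrector x + slope `|(x %% r)%Z| - 1.
Proof.
rewrite /corrector.
set k := `|(x %% r)%Z|%N.
have kr : (k < r)%N := absz_mod_lt x.
(* When the residue wraps, consistency demands that [h_nat r] vanish, which is [sum_slope]. *)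
have -> : h_nat `|((x + 1) %% r)%Z| = h_nat k.+1.
  rewrite absz_mod_succ; case: eqP => // ->.
  by rewrite /h_nat big_ord0 sumrB sum_slope sumr_const card_ord subrr.
by rewrite /h_nat big_ord_recr/= addrA.
Qed.

Lemma corrector_poisson x :
  walk_op (mix_game gamma (@game_A R) (@game_B R r 0))
    (fun y => y%:~R + corrector y) x = x%:~R + corrector x + mu.
Proof.
have up := corrector_succ x.
have := corrector_succ (x - 1); rewrite subrK => dn.
rewrite /walk_op up dn intrD intrB /mix_game /game_A /game_B /coin_p0 /coin_p1.
(* Since [r - 1] is positive, [0 ^+ (r - 1)] is 0, so the coins of game B have heads probabilities 0
   and 1. *)
rewrite !mulr1z expr0n subn_eq0 leqNgt (ltnW hr)/= addr0 !divr1.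
have := absz_mod_succ (x - 1); rewrite subrK => mod_x.
(* Both cases are indexed by the residue of [x - 1], which wraps exactly when [r] divides [x]. *)
have -> : (r%:Z %| x)%Z = (`|((x - 1) %% r)%Z|.+1 == r).
  by rewrite (sameP dvdz_mod0P eqP) -absz_eq0 mod_x; case: ifP.
rewrite mod_x; case: eqP => wrap.
  have -> : `|((x - 1) %% r)%Z|%N = r.-1 by move/(congr1 predn): wrap.
  by have := slope_wrap; rewrite /s; lra.
by have := slope_succ `|((x - 1) %% r)%Z|; rewrite /s; lra.
Qed.

End poisson_solution.

Theorem theorem4 (R : realType) (r : nat) (gamma : R) (x0 : int)
    (d : measure_display) (T : measurableType d) (P : probability T R)
    (G : nat -> T -> bool) (X : nat -> T -> int)
    (hr : (3 <= r)%N) (hgamma0 : 0 < gamma) (hgamma1 : gamma < 1)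
    (hX : mixture_play gamma (game_A R) (game_B r 0) x0 P G X) :
  is_rate_of_profit P X
    ((r%:R * gamma * (1 - gamma) * (2 - gamma) *
        ((2 - gamma) ^+ (r - 2) - gamma ^+ (r - 2))) /
     (2 * ((2 - gamma) ^+ r - gamma ^+ r) +
      r%:R * gamma * (2 - gamma) *
        ((2 - gamma) ^+ (r - 2) - gamma ^+ (r - 2)))).
Proof.
have [H hH] := corrector_bounded gamma hr.
apply: (rate_of_profit_poisson _ _ _ hX hH).
- by rewrite !ltW.
- by move=> x; rewrite /game_A; lra.
- move=> x; rewrite /game_B /coin_p0 /coin_p1 expr0n subn_eq0.
  rewrite leqNgt (ltnW hr)/= addr0 !divr1.
  by case: ifP; rewrite ?lexx ?ler01.
- exact: corrector_poisson.
Qed.
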